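(* A target pair $(H_w,H_r)$ is realizable if and only if it belongs to the full-witness closure $\mathrm{FWC}$, i.e. if and only if it possesses a full witness.
   Context: Instances and realizability. An instance consists of a finite set $E$ of items with rational values $a_i\ge 0$, positive integer sizes $d_i$, and integer capacities $0\le R<D$, with $d_i\le D$ for every item. Write $G(S)=\sum_{i\in S}a_i$ and $d(S)=\sum_{i\in S}d_i$. For $\alpha\in\{w,r\}$ let $U^\alpha(n)$ be the maximum of $G(S)$ over $n$-element sets $S\subseteq E$ with $d(S)\le D$ (for $\alpha=w$) or $d(S)\le R$ (for $\alpha=r$), with value $-\infty$ if there is none; $U^\alpha(0)=0$. The terminal count is $b_\alpha=\min\operatorname{arg\,max}_n U^\alpha(n)$. The hull is the sequence on $\{0,\dots,b_\alpha\}$ obtained by evaluating at integers the upper concave hull of the points $(n,U^\alpha(n))$, $0\le n\le b_\alpha$. A target pair $(H_w,H_r)$ consists of strictly increasing concave rational sequences $H_\alpha$ on $\{0,\dots,b_\alpha\}$ with $H_\alpha(0)=0$ (the zero sequence $(0)$, with $b_\alpha=0$, is allowed). It is realizable if a single instance has terminal counts $b_w,b_r$ and hulls exactly $H_w$ and $H_r$. Notation. $\bar H_\alpha(k)=H_\alpha(\min\{k,b_\alpha\})$. $\mathcal V_\alpha$ is the set of positive counts $n\le b_\alpha$ such that $n=b_\alpha$ or the slopes of $H_\alpha$ immediately before and after $n$ differ. $N^*=\sum_{n\in\mathcal V_w}n+\sum_{m\in\mathcal V_r}m$. Full witness. A full witness for $(H_w,H_r)$ consists of a ground set $E$ of at most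 $N^*$ items; nonnegative rational values $a_i$; subsets $X_n\subseteq E$ ($n\in\mathcal V_w$) and $Z_m\subseteq E$ ($m\in\mathcal V_r$) with $|X_n|=n$, $G(X_n)=H_w(n)$, $|Z_m|=m$, $G(Z_m)=H_r(m)$; and families $\mathcal D,\mathcal R\subseteq 2^E$ having a common positive threshold representation $\mathcal D=\{S\subseteq E:d(S)\le D\}$, $\mathcal R=\{S\subseteq E:d(S)\le R\}$ with positive rational sizes $d_i$ and rational $0\le R<D$; such that $X_n\in\mathcal D$ and $Z_m\in\mathcal R$ for all vertices, every $S\in\mathcal D$ satisfies $G(S)\le\bar H_w(|S|)$, and every $S\in\mathcal R$ satisfies $G(S)\le\bar H_r(|S|)$. $\mathrm{FWC}$ is the set of target pairs possessing a full witness. *)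

(* Defs.v *)
From mathcomp Require Import all_boot all_order all_algebra.
From mathcomp Require Import constructive_ereal.

Set Implicit Arguments.
Unset Strict Implicit.
Unset Printing Implicit Defensive.

Import Order.TTheory GRing.Theory Num.Theory.
Local Open Scope ring_scope.

Record instance := Instance {
  item : finType;
  value : item -> rat;
  isize : item -> nat;
  capD : nat;
  capR : nat;
  value_ge0 : forall i, 0 <= value i;
  isize_gt0 : forall i, (0 < isize i)%N;
  isize_le : forall i, (isize i <= capD)%N;
  capR_lt : (capR < capD)%N }.

Definition gain (E : finType) (a : E -> rat) (S : {set E}) : rat :=
  \sum_(i in S) a i.

(* U^w is [best I (capD I)] and U^r is [best I (capR I)]. *)
Definition best (I : instance) (C : nat) (n : nat) : \bar rat :=
  \big[Order.max/-oo%E]_(S : {set item I} |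
      (#|S| == n) && (\sum_(i in S) isize i <= C)%N) (gain (@value I) S)%:E.

Definition is_argmax (U : nat -> \bar rat) (n : nat) : Prop :=
  forall m, (U m <= U n)%E.

Definition is_terminal_count (U : nat -> \bar rat) (b : nat) : Prop :=
  is_argmax U b /\ forall n, is_argmax U n -> (b <= n)%N.

(* (x, y) is a convex combination of the points (i, U i), 0 <= i <= b.  Since
   0 * -oo = 0, a point at height -oo contributes nothing when its weight is 0
   and makes y = -oo otherwise. *)
Definition in_conv (U : nat -> \bar rat) (b : nat) (x : rat) (y : \bar rat)
    : Prop :=
  exists lam : 'I_b.+1 -> rat,
    [/\ forall i, 0 <= lam i,
        \sum_i lam i = 1,
        \sum_i lam i * (i : nat)%:R = x
      & (\sum_i (lam i)%:E * U i)%E = y].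

(* The upper concave hull at x is the top of the vertical section at x of the
   convex hull of the points. Rational weights suffice: at a rational abscissa,
   the maximum for rational points is attained by a rational combination. *)
Definition is_upper_hull (U : nat -> \bar rat) (b : nat) (x : rat)
    (y : \bar rat) : Prop :=
  in_conv U b x y /\ forall y', in_conv U b x y' -> (y' <= y)%E.

Record target_seq := TargetSeq {
  tcount : nat;
  tval :> 'I_tcount.+1 -> rat;
  tval0 : tval ord0 = 0;
  tval_incr : forall i j : 'I_tcount.+1, (i < j)%N -> tval i < tval j;
  tval_concave : forall i j k : 'I_tcount.+1,
    j = i.+1 :> nat -> k = j.+1 :> nat ->
    tval k - tval j <= tval j - tval i }.

Definition has_count_and_hull (U : nat -> \bar rat) (H : target_seq) : Prop :=
  is_terminal_count U (tcount H) /\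
  forall n : 'I_(tcount H).+1,
    is_upper_hull U (tcount H) (n : nat)%:R (H n)%:E.

Definition realizable (Hw Hr : target_seq) : Prop :=
  exists I : instance,
    has_count_and_hull (best I (capD I)) Hw /\
    has_count_and_hull (best I (capR I)) Hr.

Definition Hbar (H : target_seq) (k : nat) : rat :=
  H (inord (minn k (tcount H))).

Definition vertices (H : target_seq) : {set 'I_(tcount H).+1} :=
  [set n : 'I_(tcount H).+1 | (0 < n)%N &&
    (((n : nat) == tcount H) ||
     (H n - H (inord n.-1) != H (inord n.+1) - H n))].

Definition Nstar (Hw Hr : target_seq) : nat :=
  (\sum_(n in vertices Hw) n + \sum_(m in vertices Hr) m)%N.

Definition common_threshold (E : finType) (Dfam Rfam : {set {set E}}) : Prop :=
  exists (d : E -> rat) (D R : rat),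
    [/\ forall i, 0 < d i,
        0 <= R < D,
        Dfam = [set S : {set E} | \sum_(i in S) d i <= D]
      & Rfam = [set S : {set E} | \sum_(i in S) d i <= R]].

(* [wX n] and [wZ m] are constrained only when n and m are vertices. *)
Record full_witness (Hw Hr : target_seq) := FullWitness {
  wE : finType;
  wE_card : (#|wE| <= Nstar Hw Hr)%N;
  wa : wE -> rat;
  wa_ge0 : forall i, 0 <= wa i;
  wX : 'I_(tcount Hw).+1 -> {set wE};
  wZ : 'I_(tcount Hr).+1 -> {set wE};
  wX_vertex : forall n, n \in vertices Hw ->
    #|wX n| = n /\ gain wa (wX n) = Hw n;
  wZ_vertex : forall m, m \in vertices Hr ->
    #|wZ m| = m /\ gain wa (wZ m) = Hr m;
  wD : {set {set wE}};
  wR : {set {set wE}};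
  w_threshold : common_threshold wD wR;
  wX_in : forall n, n \in vertices Hw -> wX n \in wD;
  wZ_in : forall m, m \in vertices Hr -> wZ m \in wR;
  wD_le : forall S, S \in wD -> gain wa S <= Hbar Hw #|S|;
  wR_le : forall S, S \in wR -> gain wa S <= Hbar Hr #|S| }.

Definition FWC (Hw Hr : target_seq) : Prop := inhabited (full_witness Hw Hr).

(* Main.v *)
Require Import Defs.
From mathcomp Require Import all_boot all_order all_algebra.
From mathcomp Require Import constructive_ereal.
From mathcomp Require Import ring lra zify.

(** The count-and-hull condition on a profile [U] is not local: it asks for the
    upper hull at every count. The point of the proof is that it is equivalent
    to two conditions on individual item sets: [U] stays below the hull, extended
    by its last value, and meets it at the vertices. This is
    [has_count_and_hullP], and [best_hullP] is its form for an instance.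

    If [H] is the hull of [U], a vertex [n] is an exposed point: some line of
    slope strictly between the two slopes of [H] at [n] touches [H] only there.
    Were [U n] smaller than [H n], all points of [U] would lie strictly below
    that line, and so would their convex combinations, including the hull value
    at [n]. Conversely, if [U] is below [H] with equality at the vertices, every
    other count lies between two consecutive vertices (or 0 and the first one),
    where [H] is affine, so [H] is attained there by a convex combination of two
    points of [U]; a supporting line of [H] shows that nothing higher is.

    A realizing instance and a full witness then differ in two inessential ways.
    From an instance, one attaining set per vertex is chosen; restricted to the
    union of these sets, which has at most [Nstar] items, the instance becomes a
    witness, because a domination condition survives the removal of items. From a
    witness, the items larger than [D] are removed, as no set of size at most [D]
    contains one, and sizes and capacities are multiplied by a common multiple of
    their denominators, which changes neither feasible family. *)

Set Implicit Arguments.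
Unset Strict Implicit.
Unset Printing Implicit Defensive.

Import Order.TTheory GRing.Theory Num.Theory.
Local Open Scope ring_scope.

(** * Corners of concave sequences *)

Section Concave.

Variable h : nat -> rat.
Hypothesis h_concave : forall k, h k.+2 - h k.+1 <= h k.+1 - h k.

(** Extending a target sequence by its last value turns its terminal count into
    an ordinary change of slope, and counting 0 as a corner puts every count
    between two corners; corners are then the vertices together with 0. *)
Definition corner k : bool := (k == 0%N) || (h k.+1 - h k != h k - h k.-1).

Lemma slope_mono i j : (i <= j)%N -> h j.+1 - h j <= h i.+1 - h i.
Proof.
move=> /subnK <-; elim: (j - i)%N => [|k IH] //.
exact: le_trans (h_concave _) IH.
Qed.

Lemma concave_support n s :
  h n.+1 - h n <= s -> ((0 < n)%N -> s <= h n - h n.-1) ->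
  forall i, h i <= h n + s * (i%:R - n%:R).
Proof.
move=> s_ge s_le i; have [le_in|/ltnW le_ni] := leqP i n; last first.
  rewrite -(subnK le_ni); elim: (i - n)%N => [|k IH]; first by rewrite add0n; lra.
  have := slope_mono (leq_addl k n).
  by rewrite addSn -[in X in _ -> X]natr1; lra.
have -> : i = (n - (n - i))%N by lia.
have : (n - i <= n)%N by lia.
elim: (n - i)%N => [|k IH] le_kn; first by rewrite subn0; lra.
have {IH} := IH (ltnW le_kn).
have -> : (n - k = (n - k.+1).+1)%N by lia.
have := @slope_mono (n - k.+1) n.-1 ltac:(lia).
have := s_le ltac:(lia); rewrite prednK; last by lia.
by rewrite -natr1; lra.
Qed.

(** A slope strictly between those on the two sides of the corner works: the
    lines through the corner with these two slopes support [h], and the chosen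
    line is strictly above one of them on each side. *)
Lemma corner_strict_support n : corner n ->
  exists s, forall i, i != n -> h i < h n + s * (i%:R - n%:R).
Proof.
move=> c_n.
have [s [s_gt s_lt]] : exists s,
    h n.+1 - h n < s /\ ((0 < n)%N -> s < h n - h n.-1).
  case: n c_n => [_|n]; first by exists (h 1%N - h 0%N + 1); split=> //; lra.
  rewrite /corner /= => ne; exists ((h n.+2 - h n) / 2).
  by have := h_concave n; rewrite le_eqVlt (negPf ne) /= => ?; split=> *; lra.
exists s => i; rewrite neq_ltn => /orP[lt_in|lt_ni].
- have n_gt0 : (0 < n)%N by lia.
  have := @concave_support n (h n - h n.-1) _ (fun=> lexx _) i.
  have := slope_mono (leq_pred n); rewrite prednK // => le_s /(_ le_s).
  by have := s_lt n_gt0; move: lt_in; rewrite -(ltr_nat rat); nra.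
- have := @concave_support n (h n.+1 - h n) (lexx _) _ i.
  have le_s : (0 < n)%N -> h n.+1 - h n <= h n - h n.-1.
    by move=> n_gt0; have := slope_mono (leq_pred n); rewrite prednK.
  by move=> /(_ le_s); move: lt_ni; rewrite -(ltr_nat rat); nra.
Qed.

(** Take for [l] the last corner up to [n] and for [r] the first one from [n]
    on: the slope does not change strictly between them. *)
Lemma corner_interpolation b n : corner b -> (n <= b)%N ->
  exists l r t, [/\ corner l, corner r, (l <= n <= r)%N & (r <= b)%N] /\
    [/\ 0 <= t <= 1, t * l%:R + (1 - t) * r%:R = n%:R
      & t * h l + (1 - t) * h r = h n].
Proof.
move=> c_b le_nb.
have exl : exists l, corner l && (l <= n)%N by exists 0%N.
have bdl l : corner l && (l <= n)%N -> (l <= n)%N by case/andP.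
have exr : exists r, corner r && (n <= r)%N by exists b; rewrite c_b.
case: (ex_maxnP exl bdl) => l /andP[c_l le_ln] maxl.
case: (ex_minnP exr) => r /andP[c_r le_nr] minr.
have le_rb : (r <= b)%N by apply: minr; rewrite c_b.
(* When l = r the division by zero gives t = 0. *)
exists l, r, ((r%:R - n%:R) / (r%:R - l%:R)).
split; first by rewrite c_l c_r le_ln le_nr.
have [eq_lr|neq_lr] := eqVneq l r.
  have -> : n = r by lia.
  by rewrite eq_lr !subrr mul0r; split; [lra|lra|lra].
have lt_lr : (l < r)%N by lia.
have flat k : (l < k)%N -> (k < r)%N -> h k.+1 - h k = h k - h k.-1.
  move=> lt_lk lt_kr; apply/eqP; apply/negPn/negP => ne.
  have c_k : corner k by rewrite /corner ne orbT.
  have [le_kn|/ltnW le_nk] := leqP k n.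
    by have := maxl k; rewrite c_k le_kn => /(_ isT); lia.
  by have := minr k; rewrite c_k le_nk => /(_ isT); lia.
have slope k : (k + l < r)%N -> h (k + l).+1 - h (k + l) = h l.+1 - h l.
  elim: k => [|k IH] lt_kr //.
  by rewrite addSn flat ?IH //=; lia.
have affine k : (k + l <= r)%N -> h (k + l) = h l + k%:R * (h l.+1 - h l).
  elim: k => [|k IH] lt_kr; first by rewrite add0n; lra.
  have := slope k lt_kr; have := IH (ltnW lt_kr).
  by rewrite addSn -natr1; lra.
have := affine (n - l)%N; have := affine (r - l)%N.
rewrite !subnK ?(ltnW lt_lr) // => /(_ (leqnn _)) -> /(_ le_nr) ->.
rewrite !natrB ?(ltnW lt_lr) //.
have L1 : l%:R <= n%:R :> rat by rewrite ler_nat.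
have L2 : n%:R <= r%:R :> rat by rewrite ler_nat.
have L3 : l%:R < r%:R :> rat by rewrite ltr_nat.
have ne0 : r%:R - l%:R != 0 :> rat by rewrite subr_eq0; apply/eqP; lra.
split; [|by field|by field].
by rewrite divr_ge0 ?ler_pdivrMr; lra.
Qed.

End Concave.

(** * Convex hulls of finitely many points *)

Section Hull.

Variables (U : nat -> \bar rat) (b : nat).

Lemma in_conv_point (n : 'I_b.+1) : in_conv U b (n : nat)%:R (U n).
Proof.
exists (fun i => (i == n)%:R); split=> [i|||]; first by case: (_ == _).
- rewrite (bigD1 n) //= eqxx big1 ?addr0 // => i ne.
  by rewrite (negPf ne).
- rewrite (bigD1 n) //= eqxx mul1r big1 ?addr0 // => i ne.
  by rewrite (negPf ne) mul0r.
- rewrite (bigD1 n) //= eqxx mul1e big1 ?adde0 // => i ne.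
  by rewrite (negPf ne) mul0e.
Qed.

Lemma in_conv_le_affine (x : rat) y (c s : rat) :
  (forall i, (i <= b)%N -> (U i <= (c + s * (i%:R - x))%:E)%E) ->
  in_conv U b x y -> (y <= c%:E)%E.
Proof.
move=> leU [lam [lam_ge0 lam1 lamx <-]].
have -> : c = \sum_i lam i * (c + s * ((i : nat)%:R - x)).
  have -> : \sum_i lam i * (c + s * ((i : nat)%:R - x)) =
            (c - s * x) * (\sum_i lam i) + s * \sum_i lam i * (i : nat)%:R.
    rewrite !mulr_sumr -big_split /=; apply: eq_bigr => i _; ring.
  by rewrite lam1 lamx; ring.
rewrite -sumEFin; apply: lee_sum => i _.
rewrite EFinM; apply: lee_wpmul2l; first by rewrite lee_fin.
by apply: leU; rewrite -ltnS.
Qed.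

(** Strictness is not inherited term by term, since a weight may vanish. But the
    finitely many gaps to the line have a positive minimum [e], so the line
    lowered by [e] still bounds all the points. *)
Lemma in_conv_lt_affine (x : rat) y (c s : rat) :
  (forall i, (i <= b)%N -> (U i < (c + s * (i%:R - x))%:E)%E) ->
  in_conv U b x y -> (y < c%:E)%E.
Proof.
move=> ltU /in_conv_le_affine leU.
pose gap (i : 'I_b.+1) : rat := c + s * ((i : nat)%:R - x) - fine (U i).
pose e := \big[Order.min/1]_(i < b.+1 | U i \is a fin_num) gap i.
have e_gt0 : 0 < e.
  apply: lt_bigmin => // i finU; rewrite subr_gt0 -lte_fin fineK //.
  by apply: ltU; rewrite -ltnS.
apply: (@le_lt_trans _ _ (c - e)%:E); last by rewrite lte_fin; lra.
apply: (leU _ s) => i le_ib.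
have [finU|] := boolP (U i \is a fin_num).
  have := @bigmin_le_cond _ _ _ 1 (Ordinal (le_ib : (i < b.+1)%N))
     (fun i : 'I_b.+1 => U i \is a fin_num) gap finU.
  by rewrite -/e -(fineK finU) lee_fin /gap /=; lra.
by have := ltU i le_ib; case: (U i) => [u| |] // _ _; exact: leNye.
Qed.

End Hull.

(** * Target sequences and their hulls *)

Lemma target_le (H : target_seq) (i j : 'I_(tcount H).+1) :
  (i <= j)%N -> H i <= H j.
Proof.
rewrite leq_eqVlt => /orP[/eqP/val_inj -> //|lt_ij].
exact/ltW/tval_incr.
Qed.

Lemma HbarE (H : target_seq) (n : 'I_(tcount H).+1) : Hbar H n = H n.
Proof. by rewrite /Hbar (minn_idPl _) ?inord_val // -ltnS. Qed.

Lemma Hbar0 (H : target_seq) : Hbar H 0 = 0.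
Proof. by rewrite (HbarE ord0) tval0. Qed.

Lemma Hbar_ge (H : target_seq) n : (tcount H <= n)%N ->
  Hbar H n = Hbar H (tcount H).
Proof. by move=> le; rewrite /Hbar minnn (minn_idPr le). Qed.

Lemma Hbar_lt (H : target_seq) i j : (i < j <= tcount H)%N ->
  Hbar H i < Hbar H j.
Proof.
move=> /andP[lt_ij le_j]; apply: tval_incr.
by rewrite !inordK; lia.
Qed.

Lemma Hbar_le (H : target_seq) i : Hbar H i <= Hbar H (tcount H).
Proof. by apply: target_le; rewrite !inordK; lia. Qed.

Lemma Hbar_concave (H : target_seq) k :
  Hbar H k.+2 - Hbar H k.+1 <= Hbar H k.+1 - Hbar H k.
Proof.
have [le_k|lt_k] := leqP k.+2 (tcount H).
  by apply: tval_concave; rewrite !inordK; lia.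
have -> : Hbar H k.+2 = Hbar H k.+1.
  by rewrite [LHS]Hbar_ge ?[RHS]Hbar_ge //; lia.
rewrite subrr subr_ge0; apply: target_le.
by rewrite !inordK; lia.
Qed.

Lemma corner_Hbar (H : target_seq) (n : 'I_(tcount H).+1) :
  corner (Hbar H) n = ((n : nat) == 0%N) || (n \in vertices H).
Proof.
rewrite /corner inE; case: n => -[|n] lt_n //=.
have -> : H (Ordinal lt_n) = Hbar H n.+1 by rewrite -HbarE.
have -> : H (inord n) = Hbar H n by rewrite -HbarE inordK //; lia.
have [eq_n|ne_n] := eqVneq n.+1 (tcount H).
  have lt_H : Hbar H n < Hbar H n.+1 by apply: Hbar_lt; rewrite ltnSn eq_n /=.
  have -> : Hbar H n.+2 = Hbar H n.+1 by rewrite [LHS]Hbar_ge ?eq_n //; lia.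
  by rewrite subrr lt_eqF ?subr_gt0.
have -> : H (inord n.+2) = Hbar H n.+2 by rewrite -HbarE inordK //; lia.
by rewrite eq_sym.
Qed.

(** Corners at which [U] and [H] must agree are exposed points of the hull, and
    they suffice to recover it by interpolation. The hypothesis at 0 covers the
    corner that is not a vertex. *)
Lemma has_count_and_hullP (U : nat -> \bar rat) (H : target_seq) :
  U 0%N = 0%E ->
  has_count_and_hull U H <->
  (forall n, (U n <= (Hbar H n)%:E)%E) /\
  (forall n, n \in vertices H -> U n = (H n)%:E).
Proof.
move=> U0; set b := tcount H.
have corner_b : corner (Hbar H) b.
  have := corner_Hbar (@ord_max b); rewrite inE /= eqxx andbT => ->.
  by case: (b).
split=> [[[maxb minb] hullU]|[U_le U_vertex]].
- have U_le_small (n : 'I_b.+1) : (U n <= (Hbar H n)%:E)%E.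
    by rewrite HbarE; apply: (hullU n).2; apply: in_conv_point.
  have U_corner (n : 'I_b.+1) : corner (Hbar H) n -> U n = (Hbar H n)%:E.
    move=> /(corner_strict_support (Hbar_concave H))[s lt_s].
    apply/le_anti; rewrite U_le_small leNgt /=; apply/negP => lt_U.
    have [/in_conv_lt_affine in_n _] := hullU n.
    have := in_n (Hbar H n) s; rewrite HbarE ltxx => /(_ _)/notF; apply=> i le_i.
    have [->|ne_in] := eqVneq i n; first by rewrite subrr mulr0 addr0 -HbarE.
    apply: le_lt_trans (U_le_small (Ordinal (le_i : (i < b.+1)%N))) _.
    by rewrite lte_fin -HbarE; apply: lt_s.
  split=> n.
    have [le_nb|/ltnW le_bn] := leqP n b.
      exact: (U_le_small (Ordinal (le_nb : (n < b.+1)%N))).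
    by rewrite Hbar_ge // -(U_corner ord_max corner_b).
  by move=> n_v; rewrite -HbarE; apply: U_corner; rewrite corner_Hbar n_v orbT.
- have U_corner n : (n <= b)%N -> corner (Hbar H) n -> U n = (Hbar H n)%:E.
    move=> le_nb; have := corner_Hbar (Ordinal (le_nb : (n < b.+1)%N)).
    move=> /= -> /orP[/eqP->|/U_vertex]; first by rewrite U0 Hbar0.
    by rewrite -HbarE.
  split; [split=> [m|n maxn]|move=> n; split].
  + by rewrite (U_corner b) // (le_trans (U_le m)) // lee_fin Hbar_le.
  + rewrite leqNgt; apply/negP => lt_nb; have := le_trans (maxn b) (U_le n).
    by rewrite (U_corner b) // lee_fin leNgt Hbar_lt // lt_nb leqnn.
  + have le_nb : (n <= b)%N by rewrite -ltnS.
    (* The hull value is attained by weights t and 1 - t on the corners around n;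
       off these corners the weight 0 makes the value of U irrelevant, even -oo. *)
    have [l [r [t]]] := corner_interpolation corner_b le_nb.
    case=> -[c_l c_r /andP[le_ln le_nr] le_rb] [/andP[t_ge0 t_le1] t_n t_H].
    have le_lb := leq_trans le_ln le_nb.
    pose L := Ordinal (le_lb : (l < b.+1)%N).
    pose R := Ordinal (le_rb : (r < b.+1)%N).
    pose lam i := t * (i == L)%:R + (1 - t) * (i == R)%:R.
    have sum_lam f : \sum_i lam i * f i = t * f L + (1 - t) * f R.
      rewrite (eq_bigr (fun i => t * ((i == L)%:R * f i) +
                                 (1 - t) * ((i == R)%:R * f i))); last first.
        by move=> i _; rewrite /lam; ring.
      have sum_delta (K : 'I_b.+1) : \sum_i (i == K)%:R * f i = f K.
        rewrite (bigD1 K) //= eqxx mul1r big1 ?addr0 // => i /negPf ->.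
        by rewrite mul0r.
      by rewrite big_split -!mulr_sumr /= !sum_delta.
    exists lam; split.
    * by move=> i; rewrite addr_ge0 // mulr_ge0 ?subr_ge0.
    * have := sum_lam (fun=> 1); rewrite !mulr1 addrC subrK => <-.
      by apply: eq_bigr => i _; rewrite mulr1.
    * by rewrite sum_lam.
    * rewrite -HbarE -t_H -(sum_lam (fun i => Hbar H i)) -sumEFin.
      apply: eq_bigr => i _; rewrite EFinM /lam.
      have [->|ne_L] := eqVneq i L; first by rewrite U_corner.
      have [->|ne_R] := eqVneq i R; first by rewrite U_corner.
      by rewrite !mulr0 addr0 !mul0e.
  + move=> y; pose s := Hbar H n.+1 - Hbar H n.
    apply: (@in_conv_le_affine _ _ _ _ _ s).
    move=> i _; apply: le_trans (U_le i) _; rewrite lee_fin -HbarE.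
    apply: (concave_support (Hbar_concave H)) => // n_gt0.
    by have := slope_mono (Hbar_concave H) (leq_pred n); rewrite prednK.
Qed.

(** * Hulls of instances *)

Lemma best_leP (I : instance) C n x :
  (best I C n <= x%:E)%E <->
  (forall S : {set item I}, #|S| = n -> (\sum_(i in S) isize i <= C)%N ->
    gain (@value I) S <= x).
Proof.
split=> [le_x S card_S size_S|le_x].
  rewrite -lee_fin; apply: le_trans le_x; rewrite /best.
  by apply: (@le_bigmax_cond _ _ _ _ S); rewrite card_S eqxx.
apply: bigmax_le => [|S /andP[/eqP card_S size_S]]; first exact: leNye.
by rewrite lee_fin le_x.
Qed.

Lemma best_attained (I : instance) C n x :
  best I C n = x%:E ->
  exists S : {set item I}, [/\ #|S| = n, (\sum_(i in S) isize i <= C)%N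
                             & gain (@value I) S = x].
Proof.
rewrite /best; elim/big_ind: _ => // [x1 x2|S /andP[/eqP card_S size_S] [gainS]].
  by move=> IH1 IH2; rewrite maxEle; case: ifP.
by exists S.
Qed.

Lemma best0 (I : instance) C : best I C 0 = 0%E.
Proof.
apply/le_anti/andP; split.
  by apply/best_leP => S /cards0_eq -> _; rewrite /gain big_set0.
have gain0 : gain (@value I) set0 = 0 by rewrite /gain big_set0.
rewrite -[X in (X <= _)%E]/((0 : rat)%:E) -gain0.
by apply: (@le_bigmax_cond _ _ _ _ set0); rewrite cards0 big_set0.
Qed.

(** Unlike the hull condition, both halves speak of single item sets, so they
    can be carried between ground sets. *)
Lemma best_hullP (I : instance) C (H : target_seq) :
  has_count_and_hull (best I C) H <->
  (forall S : {set item I}, (\sum_(i in S) isize i <= C)%N ->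
     gain (@value I) S <= Hbar H #|S|) /\
  (forall n, n \in vertices H -> exists S : {set item I},
     [/\ #|S| = n, (\sum_(i in S) isize i <= C)%N & gain (@value I) S = H n]).
Proof.
rewrite has_count_and_hullP ?best0 //; split=> -[le_H eq_H]; split.
- by move=> S size_S; apply: (best_leP _ _ _ _).1 size_S.
- by move=> n /eq_H /best_attained.
- by move=> n; apply/best_leP => S <-; apply: le_H.
- move=> n n_v; have [S [card_S size_S gain_S]] := eq_H n n_v.
  apply/le_anti/andP; split.
    by apply/best_leP => T card_T /le_H; rewrite card_T HbarE.
  rewrite -gain_S; apply: (@le_bigmax_cond _ _ _ _ S).
  by rewrite card_S eqxx.
Qed.

(** * Clearing denominators and restricting the ground set *)

Lemma common_multiplier (s : seq rat) : {in s, forall x, 0 <= x} ->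
  exists2 M : nat, (0 < M)%N & {in s, forall x, M%:R * x \is a Num.nat}.
Proof.
elim: s => [|x s IH] s_ge0; first by exists 1%N.
have [|M M_gt0 Ms] := IH; first by move=> y ys; rewrite s_ge0 // inE ys orbT.
exists (M * `|denq x|)%N; first by rewrite muln_gt0 M_gt0 absz_gt0 denq_neq0.
move=> y; rewrite inE natrM => /predU1P[->|ys]; last first.
  by rewrite mulrAC; apply: rpredM; [apply: Ms|apply: rpred_nat].
have -> : M%:R * `|denq x|%:R * x = M%:R * `|numq x|%:R.
  rewrite -mulrA; congr (_ * _); rewrite [in RHS]natr_absz ger0_norm; last first.
    by rewrite numq_ge0 s_ge0 // mem_head.
  by rewrite natr_absz gtr0_norm ?denq_gt0 // numqE mulrC.
by apply: rpredM; apply: rpred_nat.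
Qed.

Section Restriction.

Variables (T : finType) (P : pred T).

Implicit Types (S : {set {i | P i}}) (X : {set T}).

Lemma sum_imset_val (V : nmodType) (f : T -> V) S :
  \sum_(i in val @: S) f i = \sum_(i in S) f (val i).
Proof. by rewrite big_imset //= => i j _ _ /val_inj. Qed.

Lemma card_imset_val S : #|val @: S| = #|S|.
Proof. exact/card_imset/val_inj. Qed.

Lemma imset_val_preimset X : {subset X <= P} ->
  val @: (val @^-1: X : {set {i | P i}}) = X.
Proof.
move=> sXP; apply/setP => i; apply/imsetP/idP => [[j]|iX].
  by rewrite inE => jX ->.
by exists (exist _ i (sXP i iX)); rewrite ?inE.
Qed.

End Restriction.

Lemma card_bigcup_le (T I : finType) (P : pred I) (F : I -> {set T}) :
  (#|\bigcup_(i | P i) F i| <= \sum_(i | P i) #|F i|)%N.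
Proof.
elim/big_rec2: _ => [|i n A _ IH]; first by rewrite cards0.
by apply: leq_trans (leq_card_setU _ _) _; rewrite leq_add2l.
Qed.

(** * Instances and full witnesses *)

Lemma choose_attaining_sets (I : instance) C (H : target_seq) :
  has_count_and_hull (best I C) H ->
  exists X : 'I_(tcount H).+1 -> {set item I}, forall n, n \in vertices H ->
    [/\ #|X n| = n, (\sum_(i in X n) isize i <= C)%N
      & gain (@value I) (X n) = H n].
Proof.
move=> /best_hullP[_ exX].
have /fin_all_exists[X XP] : forall n, exists S : {set item I},
    n \in vertices H ->
    [/\ #|S| = n, (\sum_(i in S) isize i <= C)%N & gain (@value I) S = H n].
  move=> n; have [/exX[S SP]|_] := boolP (n \in vertices H); first by exists S.
  by exists set0.
by exists X.
Qed.

(** The witness lives on the union [W] of the attaining sets. A set of items of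
    [W] is a set of items of the instance with the same size and gain, so the
    domination conditions are inherited. *)
Lemma realizable_FWC (Hw Hr : target_seq) : realizable Hw Hr -> FWC Hw Hr.
Proof.
case=> I [hullD hullR].
have [X XP] := choose_attaining_sets hullD.
have [Z ZP] := choose_attaining_sets hullR.
move: hullD hullR => /best_hullP[leD _] /best_hullP[leR _].
pose W := \bigcup_(n in vertices Hw) X n :|: \bigcup_(m in vertices Hr) Z m.
pose E : finType := {i : item I | i \in W}.
pose a (i : E) := value (val i).
pose d (i : E) : rat := (isize (val i))%:R.
have dE (S : {set E}) C :
    (\sum_(i in S) d i <= C%:R) = (\sum_(i in val @: S) isize i <= C)%N.
  by rewrite -natr_sum ler_nat -(sum_imset_val (@isize I) S).
have aE (S : {set E}) : gain a S = gain (@value I) (val @: S).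
  exact/esym/sum_imset_val.
have XW n : n \in vertices Hw -> {subset X n <= [in W]}.
  move=> n_v i iX; apply/setUP; left.
  by apply/bigcupP; exists n.
have ZW m : m \in vertices Hr -> {subset Z m <= [in W]}.
  move=> m_v i iZ; apply/setUP; right.
  by apply/bigcupP; exists m.
pose X' n : {set E} := val @^-1: X n.
pose Z' m : {set E} := val @^-1: Z m.
constructor.
apply: (@FullWitness Hw Hr E _ a _ X' Z' _ _
  [set S : {set E} | \sum_(i in S) d i <= (capD I)%:R]
  [set S : {set E} | \sum_(i in S) d i <= (capR I)%:R]).
- rewrite card_sig; apply: leq_trans (leq_card_setU _ _) _.
  apply: leq_add; apply: leq_trans (card_bigcup_le _ _) _.
    by apply: leq_sum => n /XP[-> _ _].
  by apply: leq_sum => m /ZP[-> _ _].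
- by move=> i; apply: value_ge0.
- move=> n n_v; have [card_X _ gain_X] := XP n n_v.
  by rewrite aE -card_imset_val imset_val_preimset //; apply: XW.
- move=> m m_v; have [card_Z _ gain_Z] := ZP m m_v.
  by rewrite aE -card_imset_val imset_val_preimset //; apply: ZW.
- exists d, (capD I)%:R, (capR I)%:R; split=> //.
    by move=> i; rewrite ltr0n isize_gt0.
  by rewrite ler0n ltr_nat capR_lt.
- move=> n n_v; have [_ size_X _] := XP n n_v.
  by rewrite inE dE imset_val_preimset //; apply: XW.
- move=> m m_v; have [_ size_Z _] := ZP m m_v.
  by rewrite inE dE imset_val_preimset //; apply: ZW.
- by move=> S; rewrite inE dE aE -card_imset_val => /leD.
- by move=> S; rewrite inE dE aE -card_imset_val => /leR.
Qed.

(** The instance keeps the items that fit in [D], which include all those of the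
    sets [X n] and [Z m], and scales sizes and capacities by [M]. *)
Lemma FWC_realizable (Hw Hr : target_seq) : FWC Hw Hr -> realizable Hw Hr.
Proof.
case=> -[E _ a a_ge0 X Z XP ZP Df Rf [d [D [R [d_gt0 /andP[R_ge0 lt_RD] -> ->]]]]].
move=> XD ZR leD leR.
have D_ge0 : 0 <= D by apply: le_trans (ltW lt_RD).
have [|M M_gt0 Mnat] := @common_multiplier [:: D, R & [seq d i | i : E]].
  move=> x; rewrite !inE => /or3P[/eqP->|/eqP->|/imageP[i _ ->]] //.
  exact: ltW.
have MD : M%:R * D \is a Num.nat by apply: Mnat; rewrite inE eqxx.
have MR : M%:R * R \is a Num.nat by apply: Mnat; rewrite !inE eqxx orbT.
have Md i : M%:R * d i \is a Num.nat.
  by apply: Mnat; rewrite !inE image_f ?orbT.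
have MR_gt0 : 0 < M%:R :> rat by rewrite ltr0n.
pose T : finType := {i : E | d i <= D}.
pose sz (i : E) := Num.truncn (M%:R * d i).
have szK i : (sz i)%:R = M%:R * d i by rewrite truncnK.
have sz_gt0 i : (0 < sz i)%N by rewrite -(ltr0n rat) szK mulr_gt0.
have sz_le (i : T) : (sz (val i) <= Num.truncn (M%:R * D))%N.
  by rewrite -(ler_nat rat) szK truncnK // ler_pM2l //; exact: (valP i).
have lt_cap : (Num.truncn (M%:R * R) < Num.truncn (M%:R * D))%N.
  by rewrite -(ltr_nat rat) !truncnK // ltr_pM2l.
pose I := @Instance T (fun i => a (val i)) (fun i => sz (val i)) _ _
  (fun i => a_ge0 (val i)) (fun i => sz_gt0 (val i)) sz_le lt_cap.
have szE (S : {set T}) C : M%:R * C \is a Num.nat ->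
    (\sum_(i in S) sz (val i) <= Num.truncn (M%:R * C))%N =
    (\sum_(i in val @: S) d i <= C).
  move=> MC; rewrite -(ler_nat rat) natr_sum truncnK //.
  rewrite -(sum_imset_val (fun i => (sz i)%:R : rat) S).
  by rewrite (eq_bigr _ (fun i _ => szK i)) -mulr_sumr ler_pM2l.
have aE (S : {set T}) : gain (@value I) S = gain a (val @: S).
  exact/esym/sum_imset_val.
have fits (S : {set E}) : \sum_(i in S) d i <= D ->
    {subset S <= [pred i | d i <= D]}.
  move=> le_D i iS; rewrite inE; apply: le_trans le_D.
  by rewrite (bigD1 i) //= lerDl sumr_ge0 // => j _; apply: ltW.
exists I; split; apply/best_hullP; split.
- move=> S; rewrite /= szE // => size_S.
  by rewrite aE -card_imset_val; apply: leD; rewrite inE.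
- move=> n n_v; have [card_X gain_X] := XP n n_v.
  have := XD n n_v; rewrite inE => size_X; exists (val @^-1: X n).
  by rewrite aE -card_imset_val /= szE // imset_val_preimset //; apply: fits.
- move=> S; rewrite /= szE // => size_S.
  by rewrite aE -card_imset_val; apply: leR; rewrite inE.
- move=> m m_v; have [card_Z gain_Z] := ZP m m_v.
  have := ZR m m_v; rewrite inE => size_Z; exists (val @^-1: Z m).
  rewrite aE -card_imset_val /= szE // imset_val_preimset //; apply: fits.
  exact: le_trans (ltW lt_RD).
Qed.

Theorem theorem3p10 (Hw Hr : target_seq) : realizable Hw Hr <-> FWC Hw Hr.
Proof. by split; [apply: realizable_FWC|apply: FWC_realizable]. Qed.
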